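(* Let $R$ be an integral domain and $n\geq 2$. Then the set $GC_n(R)$ of all invertible $n\times n$ Christoffel matrices over $R$ is an abelian subgroup of $GL_n(R)$. The subset $H$ of $GC_n(R)$ consisting of all type $1$ invertible Christoffel matrices is a subgroup of $GC_n(R)$. If $R$ is a field, then the quotient $GC_n(R)/H$ is isomorphic to $(\mathbb{Z}/n\mathbb{Z})^\times$.
   Context: For $n\geq 2$, $(\mathbb{Z}/n\mathbb{Z})^\times$ denotes the multiplicative group of integers modulo $n$, identified with the set of integers in $\{0,1,\dots,n-1\}$ coprime to $n$. A binary word on two distinct symbols $a,b$ (ordered formally by $a<b$) is a Christoffel word if it is Lyndon (strictly smaller lexicographically than all its other cyclic conjugates) and cyclically balanced (any two cyclic factors of the same length have numbers of occurrences of $a$ differing by at most $1$). For $m\in(\mathbb{Z}/n\mathbb{Z})^\times$, $c_m(a,b)$ denotes the Christoffel word of length $n$ on the distinct symbols $a,b$, beginning in $a$, with exactly $m$ occurrences of $a$ and $n-m$ occurrences of $b$. The Christoffel matrix $C_m(a,b)$ of size $n$ and type $m$ is the $n\times n$ matrix whose rows are the $n$ cyclic conjugates of $c_m(a,b)$ arranged in increasing lexicographic order (relative to $a<b$), so that its first row is $c_m(a,b)$. Equivalently: the first column of $C_m(a,b)$ consists of $m$ entries $a$ followed by $n-m$ entries $b$, and each subsequent column is the cyclic downward shift by $m$ positions of the preceding column. In particular the type $1$ matrix $C_1(a,b)$ has $a$ on the diagonal and $b$ elsewhere. A Christoffel matrix over $R$ is a matrix $C_m(a,b)$ with $m\in(\mathbb{Z}/n\mathbb{Z})^\times$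 and $a,b\in R$, $a\neq b$ (the order $a<b$ is purely formal). Invertible means invertible over $R$, i.e. the determinant is a unit of $R$. *)

(* Defs.v *)
From HB Require Import structures.
From mathcomp Require Import all_boot all_order all_algebra.
From mathcomp Require Import boolp classical_sets functions.

Set Implicit Arguments.
Unset Strict Implicit.
Unset Printing Implicit Defensive.

Import Order.TTheory GRing.Theory.
Local Open Scope classical_set_scope.
Local Open Scope ring_scope.

(* Binary words are [seq bool]: [false] stands for the smaller letter a and
   [true] for the larger letter b; [seqlexi] is the lexicographic order.
   The conjugates of [w] are the rotations [rot i w]. *)
Definition lyndon (w : seq bool) : Prop :=
  forall i, (0 < i < size w)%N -> ((w : seqlexi bool) < rot i w)%O.

(* The cyclic factors of length l of [w] are the words [take l (rot i w)]. *)
Definition cyclically_balanced (w : seq bool) : Prop :=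
  forall l i j, (l <= size w)%N -> (i < size w)%N -> (j < size w)%N ->
    (count_mem false (take l (rot i w))
       <= (count_mem false (take l (rot j w))).+1)%N.

Definition christoffel_word (w : seq bool) : Prop :=
  lyndon w /\ cyclically_balanced w.

Definition sorted_conjugates (w : seq bool) : seq (seqlexi bool) :=
  sort <=%O [seq (rot i w : seqlexi bool) | i <- iota 0 (size w)].

Definition word_mx (R : Type) (n : nat) (w : n.-tuple bool) (a b : R) :
    'M[R]_n :=
  \matrix_(i < n, j < n)
    if nth false (nth [::] (sorted_conjugates w) i) j then b else a.

(* [A] is the matrix C_m(a,b) of size n. For m < n coprime to n the word [w] is
   unique, and it begins with [false] because it is minimal among its
   conjugates. *)
Definition is_christoffel_mx (R : Type) (n m : nat) (a b : R)
    (A : 'M[R]_n) : Prop :=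
  exists w : n.-tuple bool,
    [/\ christoffel_word w, count_mem false w = m & A = word_mx w a b].

(* MathComp's {'GL_n[R]} requires a finite ring. *)
Record GL (n : nat) (R : comUnitRingType) :=
  MkGL { GLmx :> 'M[R]_n; GLmxP : GLmx \in unitmx }.

Section GLgroup.
Variables (n : nat) (R : comUnitRingType).
Implicit Types g h : GL n R.

HB.instance Definition _ := [isSub for @GLmx n R].
HB.instance Definition _ := [Choice of GL n R by <:].

Fact GL_one_subproof : (1%:M : 'M[R]_n) \in unitmx.
Proof. exact: unitmx1. Qed.
Fact GL_mul_subproof g h : (g *m h) \in unitmx.
Proof. by rewrite unitmx_mul !GLmxP. Qed.
Fact GL_inv_subproof g : invmx g \in unitmx.
Proof. by rewrite unitmx_inv GLmxP. Qed.

Definition GL_one : GL n R := MkGL GL_one_subproof.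
Definition GL_mul g h : GL n R := MkGL (GL_mul_subproof g h).
Definition GL_inv g : GL n R := MkGL (GL_inv_subproof g).

Fact GL_mulA : associative GL_mul.
Proof. by move=> x y z; apply: val_inj; rewrite /= mulmxA. Qed.
Fact GL_mul1 : left_id GL_one GL_mul.
Proof. by move=> x; apply: val_inj; rewrite /= mul1mx. Qed.
Fact GL_1mul : right_id GL_one GL_mul.
Proof. by move=> x; apply: val_inj; rewrite /= mulmx1. Qed.
Fact GL_mulV : left_inverse GL_one GL_inv GL_mul.
Proof. by move=> x; apply: val_inj; rewrite /= mulVmx ?GLmxP. Qed.
Fact GL_Vmul : right_inverse GL_one GL_inv GL_mul.
Proof. by move=> x; apply: val_inj; rewrite /= mulmxV ?GLmxP. Qed.

HB.instance Definition _ :=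
  isGroup.Build (GL n R) GL_mulA GL_mul1 GL_1mul GL_mulV GL_Vmul.

End GLgroup.

Section Subgroups.
Variable G : groupType.
Implicit Types (H K X Y : set G).
Local Open Scope group_scope.

Definition is_subgroup K : Prop :=
  [/\ K 1, (forall x y, K x -> K y -> K (x * y)) & (forall x, K x -> K x^-1)].

Definition is_abelian K : Prop := forall x y, K x -> K y -> x * y = y * x.

Definition left_coset (g : G) H : set G := [set g * h | h in H].

Definition cosets_of K H : set (set G) := [set left_coset g H | g in K].

Definition setprod X Y : set G := [set x * y | x in X & y in Y].

(* K / H, with product [setprod], is isomorphic to Q; meant for subgroups
   H of K such that H is normal in K. *)
Definition quotient_isomorphic K H (Q : groupType) : Prop :=
  exists f : set G -> Q,
    set_bij (cosets_of K H) [set: Q] f /\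
    forall X Y, cosets_of K H X -> cosets_of K H Y ->
      f (setprod X Y) = f X * f Y.

End Subgroups.

Definition GC (n : nat) (R : comUnitRingType) : set (GL n R) :=
  [set g | exists (m : nat) (a b : R),
     [/\ (m < n)%N, coprime m n, a != b & is_christoffel_mx m a b g]].

Definition GC_type1 (n : nat) (R : comUnitRingType) : set (GL n R) :=
  [set g | exists a b : R, a != b /\ is_christoffel_mx 1 a b g].

Arguments GC : clear implicits.
Arguments GC_type1 : clear implicits.

(* Main.v *)
Require Import Defs.
From mathcomp Require Import all_boot all_order all_algebra.
From mathcomp Require Import boolp classical_sets functions.
From mathcomp Require Import zify ring.

(** Fix n and, for a natural number c, let P_c be the matrix sending the basis
    vector e_j to the sum of e_(t mod n) over the window j c <= t < (j + 1) c.
    In the ring of polynomials modulo x^n - 1 it maps x^j to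
    x^(jc) + ... + x^(jc+c-1).

    The Christoffel matrix C_m(a, b) is (a - b) P_m + b J, where J is the
    all-ones matrix.  Indeed the number of letters a in the first l places of
    row x of P_c is the number of t < l c congruent to x modulo n.  That number
    is a non-increasing function of x and varies by at most one with x, so the
    rows are balanced words, they occur in lexicographic order, and they are
    the conjugates of the first one ([mechanical_word_lt],
    [balanced_mechanical_word], [sorted_conjugates_mechanical_word]).
    Conversely, a balanced word that is lexicographically least among its
    conjugates has, in each prefix, at least as many letters a as any conjugate
    has ([lyndon_count_max]).  As these numbers differ by at most one and their
    average over the conjugates is known, all prefix counts are forced, and the
    word is the first row of P_m ([christoffel_word_unique]).

    Applying P_d and then P_c to e_k glues consecutive windows together, so
    that P_c P_d = P_(cd) ([mechanical_mxM]); moreover P_1 = 1 and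
    P_(c + qn) = P_c + q J, whence P_n = J.  The matrices d P_m + c J with
    m coprime to n and d nonzero are therefore stable under product, commute,
    and have a type, namely m modulo n, which is multiplicative.  If such a
    matrix is invertible then d and its row sum d m + c n are units
    ([affine_mx_units]), and solving a linear equation gives an inverse of the
    same shape, whose type is the inverse of m ([affine_mx_inverse]).

    The type is read off the first column ([affine_mx_inj]), and the invertible
    matrices of type 1 form the kernel of the type.  Over a field each residue
    class is attained, because m + c n is nonzero for c = 0 or c = 1:
    otherwise m and n would both vanish in the field although they are coprime
    ([has_type_exists]). *)

Set Implicit Arguments.
Unset Strict Implicit.
Unset Printing Implicit Defensive.

Import Order.TTheory GRing.Theory.
Local Open Scope classical_set_scope.
Local Open Scope nat_scope.

(** * Counting a residue class in an interval *)

Definition rescount (n x s e : nat) : nat :=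
  \sum_(s <= t < e) (t == x %[mod n]).

Lemma rescount_cat n x s e f :
  s <= e -> e <= f -> rescount n x s e + rescount n x e f = rescount n x s f.
Proof. by move=> se ef; rewrite /rescount -big_cat_nat. Qed.

Lemma rescount_shift n k x s e :
  rescount n (x + k) (s + k) (e + k) = rescount n x s e.
Proof.
by rewrite /rescount big_addn addnK; apply: eq_bigr => t _; rewrite eqn_modDr.
Qed.

Lemma rescount_congr n x y s e : x = y %[mod n] ->
  rescount n x s e = rescount n y s e.
Proof. by rewrite /rescount => ->. Qed.

Lemma rescount_shift_period n q x s e :
  rescount n x (s + q * n) (e + q * n) = rescount n x s e.
Proof.
rewrite -(rescount_shift n (q * n) x s).
by apply: rescount_congr; rewrite addnC modnMDl.
Qed.

(** The right-hand side is the ceiling of (L - x) / n, in a form that needs no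
    signed quantity. *)
Lemma rescount_prefix n x L : x < n -> rescount n x 0 L = (L + (n.-1 - x)) %/ n.
Proof.
move=> xn; have n0 : 0 < n by apply: leq_ltn_trans xn.
elim: L => [|L IH]; first by rewrite /rescount big_geq // divn_small //; lia.
rewrite /rescount big_nat_recr //= -/(rescount n x 0 L) IH addSn divnS // addnC.
congr (_ + _); congr nat_of_bool.
rewrite [x %% n]modn_small //.
have -> : (L + (n.-1 - x)).+1 = (L + (n - x)) by lia.
have [r rn [q ->]] : exists2 r, r < n & exists q, L = q * n + r.
  by exists (L %% n); [rewrite ltn_mod | exists (L %/ n); rewrite -divn_eq].
rewrite modnMDl modn_small // -addnA /dvdn modnMDl.
apply/eqP/eqP => [->|]; first by rewrite subnKC ?modnn // ltnW.
by move/eqP/dvdnP => [[|[|k]]]; nia.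
Qed.

Lemma rescount_period n x s : 0 < n -> rescount n x s (s + n) = 1.
Proof.
move=> n0; rewrite (@rescount_congr _ _ (x %% n)) ?modn_mod //.
have xn : x %% n < n by rewrite ltn_mod.
apply/eqP; rewrite -(eqn_add2l (rescount n (x %% n) 0 s)).
rewrite rescount_cat ?leq_addr //.
by rewrite !rescount_prefix // addnAC divnDr // divnn n0.
Qed.

Lemma rescount_le1 n x s e : 0 < n -> e <= s + n -> rescount n x s e <= 1.
Proof.
move=> n0 es; have [se|/ltnW es'] := leqP s e; last first.
  by rewrite /rescount big_geq.
by rewrite -(rescount_period x s n0) -(rescount_cat n x se es) leq_addr.
Qed.

Lemma rescount_periods n x s q : 0 < n -> rescount n x s (s + q * n) = q.
Proof.
move=> n0; elim: q => [|q IH]; first by rewrite /rescount mul0n addn0 big_geq.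
rewrite -(@rescount_cat n x s (s + q * n)) ?leq_addr // mulSn; last lia.
by rewrite IH [n + _]addnC addnA rescount_period // addn1.
Qed.

(** Windows of width c tile an interval: this gluing is what makes the
    mechanical matrices multiplicative. *)
Lemma rescount_concat n x c s e : s <= e ->
  \sum_(s <= t < e) rescount n x (t * c) (t.+1 * c) =
    rescount n x (s * c) (e * c).
Proof.
elim: e => [|e IH].
  by rewrite leqn0 => /eqP ->; rewrite /rescount !big_geq.
rewrite leq_eqVlt => /orP[/eqP ->|se]; first by rewrite /rescount !big_geq.
by rewrite big_nat_recr //= IH // rescount_cat ?leq_mul.
Qed.

(** * Mechanical words and their lexicographic order *)

(** At the first place where the words differ, the counts of the prefixes ending
    there differ too, and the word with more letters [false] has [false] at
    that place. *)
Lemma prefix_counts_lexi (s t : seq bool) : size s = size t ->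
    (forall l, l <= size s ->
       count_mem false (take l t) <= count_mem false (take l s)) ->
  ((s : seqlexi bool) <= t)%O.
Proof.
elim: s t => [|x s IH] [|y t] //= [st] le_ts.
rewrite lexi_cons; apply/andP; split.
  by have := le_ts 1 isT; case: (x); case: (y); rewrite /= ?take0.
apply/implyP => yx; apply: IH => // l ls.
by move: (le_ts l.+1 ls) => /=; case: (x) yx; case: (y) => //= _; lia.
Qed.

Lemma prefix_counts_inj (s t : seq bool) : size s = size t ->
    (forall l, l <= size s ->
       count_mem false (take l s) = count_mem false (take l t)) ->
  s = t.
Proof.
move=> st eq_st; apply: (@le_anti _ (seqlexi bool)); apply/andP.
by split; apply: prefix_counts_lexi => // l; rewrite -?st => /eq_st ->.
Qed.

(** At the first difference s has [false] and t has [true]; if t nevertheless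
    has more letters [false] up to l, the factors between that place and l make
    up for a deficit, so their counts differ by at least two. *)
Lemma lexi_count_defect (s t : seq bool) l :
    size s = size t -> l <= size s -> ((s : seqlexi bool) <= t)%O ->
    count_mem false (take l s) < count_mem false (take l t) ->
  exists q k, q + k <= l /\
    (count_mem false (take k (drop q s))).+1 <
      count_mem false (take k (drop q t)).
Proof.
elim: s t l => [|x s IH] [|y t] [|l] //= [st] ls.
rewrite lexi_cons => /andP[xy /implyP yx] lt_st.
have [yx'|] := boolP (y <= x)%O; last first.
  case: x xy {yx} lt_st; case: y => //= _ lt_st _.
  by exists 1, l; rewrite /= !drop0; split.
have [||||q [k [qk lt]]] // := IH t l; first exact: yx.
  by move: lt_st xy yx'; case: (x); case: (y) => //=; lia.
by exists q.+1, k.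
Qed.

Lemma rot_map_iota (T : Type) n i (f : nat -> T) : i <= n ->
  (forall j, f (n + j) = f j) -> rot i (map f (iota 0 n)) = map f (iota i n).
Proof.
move=> le_in fn; rewrite /rot -map_drop -map_take drop_iota take_iota.
rewrite (minn_idPl le_in) add0n.
have -> : map f (iota 0 i) = map f (iota n i).
  rewrite -[n in RHS]addn0 iotaDl -map_comp.
  by apply: eq_map => j /=; rewrite fn.
by rewrite -{2}(subnKC le_in) -map_cat -iotaD subnK.
Qed.

(** Row x of the matrix P_c described above, with [false] at its entries 1;
    it is meant for c <= n, when c / n is the frequency of [false].  The residue
    x plays the role of the intercept. *)
Definition mechanical_word n c x : seq bool :=
  [seq rescount n x (j * c) (j.+1 * c) == 0 | j <- iota 0 n].

Lemma size_mechanical_word n c x : size (mechanical_word n c x) = n.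
Proof. by rewrite size_map size_iota. Qed.

(** For c <= n a window meets each residue class at most once, so each letter
    records its window count exactly, and the windows of a prefix are glued. *)
Lemma count_take_mechanical_word n c x l : c <= n -> l <= n ->
  count_mem false (take l (mechanical_word n c x)) = rescount n x 0 (l * c).
Proof.
move=> cn ln; have [n0|] := posnP n.
  by move: ln; rewrite n0 leqn0 => /eqP ->; rewrite take0 /rescount big_geq.
move=> n_gt0; rewrite -map_take take_iota (minn_idPl ln) count_map -sumn_count.
rewrite sumnE big_map -[X in iota 0 X]subn0 -[iota _ _]/(index_iota 0 l).
rewrite -[0 in RHS](mul0n c) -rescount_concat //; apply: eq_bigr => j _ /=.
have : rescount n x (j * c) (j.+1 * c) <= 1 by apply: rescount_le1; lia.
by case: rescount => [|[]].
Qed.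

(** Dropping i letters translates the windows by i c, which amounts to shifting
    the intercept by i c modulo n. *)
Lemma rot_mechanical_word n c x y i : i <= n -> y + i * c = x %[mod n] ->
  rot i (mechanical_word n c x) = mechanical_word n c y.
Proof.
move=> le_in yx; rewrite /mechanical_word rot_map_iota //; last first.
  move=> j; have -> : (n + j) * c = j * c + c * n by ring.
  have -> : (n + j).+1 * c = j.+1 * c + c * n by ring.
  by rewrite rescount_shift_period.
rewrite -[i in iota i]addn0 iotaDl -map_comp; apply: eq_map => j /=.
rewrite -(rescount_congr _ _ yx) -addnS !mulnDl ![i * c + _]addnC.
by rewrite rescount_shift.
Qed.

Lemma coprime_inverse_mod c n : 0 < n -> coprime c n ->
  exists c', c' * c = 1 %[mod n].
Proof.
move=> n0 co; have [c0|] := posnP c.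
  by exists 0; move: co; rewrite c0 /coprime gcd0n => /eqP ->; rewrite !modn1.
move/egcdnP => /(_ n)[km kn eq _]; exists km.
by rewrite eq (eqP co) modnMDl.
Qed.

(** Prefix counts decrease with the intercept.  They do so strictly somewhere:
    by coprimality some prefix has its last window ending just after an element
    of the class of x, and there y has one element less. *)
Lemma mechanical_word_lt n c x y : c < n -> coprime c n -> x < y -> y < n ->
  ((mechanical_word n c x : seqlexi bool) < mechanical_word n c y)%O.
Proof.
move=> cn co xy yn; have n0 : 0 < n by lia.
have le_c := ltnW cn.
rewrite lt_neqAle; apply/andP; split; last first.
  apply: prefix_counts_lexi; rewrite !size_mechanical_word // => l ln.
  by rewrite !count_take_mechanical_word // !rescount_prefix ?leq_div2r; lia.
apply/eqP => eq_w.
have [c' cc'] := coprime_inverse_mod n0 co.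
(* The length l makes l c congruent to x + 1. *)
pose l := (c' * x.+1) %% n.
have ln : l < n by rewrite ltn_mod.
have lc : l * c %% n = x.+1.
  by rewrite modnMml mulnAC -modnMml cc' modnMml mul1n modn_small //; lia.
have := congr1 (count_mem false \o take l) eq_w.
rewrite /= !count_take_mechanical_word ?(ltnW ln) //.
rewrite !rescount_prefix //; last lia.
rewrite (divn_eq (l * c) n) lc -!addnA !divnMDl //.
have -> : (x.+1 + (n.-1 - x)) = n by lia.
by rewrite divnn n0 [in RHS](@divn_small (_ + _)); lia.
Qed.

(** The rows are strictly increasing, and each of them is a conjugate of the
    first; there are n of them, so they are all the conjugates. *)
Lemma sorted_conjugates_mechanical_word n c : c < n -> coprime c n ->
  sorted_conjugates (mechanical_word n c 0) = mkseq (mechanical_word n c) n.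
Proof.
move=> cn co; have n0 : 0 < n by lia.
set t : seq (seqlexi bool) := mkseq _ _.
have t_sorted : sorted <%O t.
  apply/(sortedP ([::] : seqlexi bool)) => i; rewrite size_mkseq => i1n.
  by rewrite !nth_mkseq ?mechanical_word_lt //; lia.
rewrite -(sort_le_id (sub_sorted (@ltW _ _) t_sorted)); apply/perm_sort_leP.
set r := map _ _.
have sub : {subset t <= r}.
  move=> w /mapP[x]; rewrite mem_iota add0n => /andP[_ xn] ->.
  have [c' cc'] := coprime_inverse_mod n0 co.
  pose i := (c' * (n - x)) %% n.
  have i_n : i < n by rewrite ltn_mod.
  apply/mapP; exists i; first by rewrite mem_iota size_mechanical_word.
  symmetry; apply: rot_mechanical_word; first exact: ltnW.
  rewrite -modnDmr modnMml mulnAC -modnMml cc' modnMml mul1n modnDmr.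
  by rewrite subnKC ?modnn ?mod0n // ltnW.
have [|sz eq_tr] := uniq_min_size (lt_sorted_uniq t_sorted) sub.
  by rewrite size_mkseq !size_map !size_iota.
apply: uniq_perm (lt_sorted_uniq t_sorted) _ => //.
by rewrite -(eq_uniq sz eq_tr) lt_sorted_uniq.
Qed.

Lemma lyndon_mechanical_word n c : c < n -> coprime c n ->
  lyndon (mechanical_word n c 0).
Proof.
move=> cn co i; rewrite size_mechanical_word => /andP[i0 i_n].
have n0 : 0 < n by lia.
pose x := n - (i * c) %% n.
have xE : x + i * c = 0 %[mod n].
  rewrite -modnDmr subnK ?modnn ?mod0n //.
  by rewrite ltnW // ltn_mod.
rewrite (rot_mechanical_word (ltnW i_n) xE); apply: mechanical_word_lt => //.
  by rewrite subn_gt0 ltn_mod.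
rewrite ltn_subrL n0 andbT lt0n -/(n %| i * c) Gauss_dvdl 1?coprime_sym //.
by rewrite gtnNdvd.
Qed.

Lemma balanced_mechanical_word n c : c <= n ->
  cyclically_balanced (mechanical_word n c 0).
Proof.
move=> cn l i j; rewrite size_mechanical_word => ln i_n j_n.
have n0 : 0 < n by lia.
have rotE k : k < n -> rot k (mechanical_word n c 0) =
    mechanical_word n c ((n - (k * c) %% n) %% n).
  move=> kn; apply: rot_mechanical_word; first exact: ltnW.
  by rewrite modnDml -modnDmr subnK ?modnn ?mod0n // ltnW // ltn_mod.
rewrite !rotE // !count_take_mechanical_word // !rescount_prefix ?ltn_mod //.
set x := _ %% n; set y := (_ - _) %% n.
have yn : y < n by rewrite ltn_mod.
have -> a : (a %/ n).+1 = (a + n) %/ n by rewrite -addn1 divnDr // divnn n0.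
by rewrite leq_div2r; lia.
Qed.

(** * Uniqueness of the Christoffel word with given letter counts *)

(** Each letter of w lies in exactly l of the cyclic factors of length l. *)
Lemma sum_count_take_rot (w : seq bool) l : l <= size w ->
  \sum_(i < size w) count_mem false (take l (rot i w)) = l * count_mem false w.
Proof.
move=> lw; have [w0|w_gt0] := posnP (size w).
  by move: lw; rewrite w0 big_ord0 leqn0 => /eqP ->.
have letter i j : i < size w -> j < size w ->
    nth true (rot i w) j = nth true w ((i + j) %% size w).
  move=> iw jw; rewrite nth_cat size_drop nth_drop.
  have [ji|ij] := ltnP j (size w - i); first by rewrite modn_small //; lia.
  rewrite nth_take; last lia.
  have -> : i + j = size w + (j - (size w - i)) by lia.
  by rewrite modnDl modn_small //; lia.
have countE (s : seq bool) k : k <= size s ->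
    count_mem false (take k s) = \sum_(j < k) ~~ nth true s j.
  move=> ks; rewrite -sumn_count sumnE big_map.
  rewrite (big_nth true) size_take_min (minn_idPl ks) big_mkord.
  by apply: eq_bigr => j _; rewrite nth_take //; case: nth.
under eq_bigr => i _ do rewrite countE ?size_rot //.
rewrite exchange_big /= -[l in RHS]card_ord -sum_nat_const.
apply: eq_bigr => j _; have jw : j < size w by apply: leq_trans lw.
have -> : count_mem false w = count_mem false (rot j w).
  by apply/permP; rewrite perm_sym perm_rot.
rewrite -[rot j w in RHS]take_size countE // size_rot; apply: eq_bigr => i _.
by rewrite !letter // addnC.
Qed.

(** Otherwise [lexi_count_defect], applied to w and its larger conjugate, would
    give two cyclic factors of equal length violating balance. *)
Lemma lyndon_count_max (w : seq bool) l i : christoffel_word w ->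
  l <= size w -> i < size w ->
  count_mem false (take l (rot i w)) <= count_mem false (take l w).
Proof.
move=> [lyn bal] lw iw; have [->|i0] := posnP i; first by rewrite rot0.
rewrite leqNgt; apply/negP => lt_l.
have lew : ((w : seqlexi bool) <= rot i w)%O by rewrite ltW ?lyn ?i0.
have [|q [k [qk]]] := lexi_count_defect _ lw lew lt_l.
  by rewrite size_rot.
have [k0|k_gt0] := posnP k; first by rewrite k0 !take0.
have qw : q < size w by lia.
have take_rot (s : seq bool) : size s = size w ->
    take k (drop q s) = take k (rot q s).
  by move=> sw; rewrite takel_cat // size_drop sw; lia.
rewrite !take_rot ?size_rot // ltnNge => /negP; apply.
rewrite rot_add_mod ?(ltnW iw) ?(ltnW qw) //.
set r := if _ then _ else _.
have [rw|wr] := ltnP r (size w); first by apply: bal; lia.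
by rewrite [rot r w]rot_oversize // -[X in take k X](rot0 w); apply: bal; lia.
Qed.

(** If A is the count of a prefix of length l, the conjugates have counts A or
    A - 1, and these add up to l m, where m is the number of letters [false].
    As A itself occurs, it is the ceiling of l m over the length of w. *)
Lemma christoffel_word_unique (w : seq bool) : christoffel_word w ->
  w = mechanical_word (size w) (count_mem false w) 0.
Proof.
move=> cw; have [w0|w_gt0] := posnP (size w).
  by rewrite w0; apply: size0nil.
apply: prefix_counts_inj; rewrite ?size_mechanical_word // => l lw.
rewrite count_take_mechanical_word ?count_size // rescount_prefix // subn0.
set A := count_mem false (take l w).
have upper : l * count_mem false w <= size w * A.
  rewrite -sum_count_take_rot // -[X in X * A]card_ord -sum_nat_const.
  by apply: leq_sum => i _; apply: lyndon_count_max.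
have lower : size w * A <= l * count_mem false w + (size w).-1.
  rewrite -sum_count_take_rot // (bigD1 (Ordinal w_gt0)) //= rot0 -/A.
  apply: (@leq_trans (A + (size w).-1 * A)); first by rewrite -mulSn prednK.
  rewrite -addnA leq_add2l.
  have cardE : (size w).-1 = \sum_(i < size w | i != Ordinal w_gt0) 1.
    have := cardC1 (Ordinal w_gt0); rewrite card_ord -sum1_card => <-.
    by apply: eq_bigl => i.
  rewrite {1 2}cardE big_distrl -big_split /=; apply: leq_sum => i _.
  rewrite mul1n addn1; have [_ /(_ l 0 i lw w_gt0 (ltn_ord i))] := cw.
  by rewrite rot0.
apply/eqP; rewrite eq_sym eqn_leq leq_divRL // -ltnS ltn_divLR //.
by apply/andP; split; lia.
Qed.

(** * Mechanical matrices form a multiplicative semigroup *)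

Local Open Scope ring_scope.

(** The matrix P_c described above. *)
Definition mechanical_mx (R : nzRingType) n c : 'M[R]_n :=
  \matrix_(i, j) (rescount n i (j * c) (j.+1 * c))%:R.

(** P_d sends e_k to the sum of the e_(t mod n) over the window of k, and P_c
    sends e_(t mod n) to the sum over t c <= s < (t + 1) c, because windows of
    indices congruent modulo n differ by a multiple of n ([collapse] below).
    These windows are consecutive, and together they make the window of k of
    width c d. *)
Lemma mechanical_mxM (R : nzRingType) n c d :
  mechanical_mx R n c *m mechanical_mx R n d = mechanical_mx R n (c * d).
Proof.
apply/matrixP => i k; rewrite !mxE.
under eq_bigr => j _ do rewrite !mxE -natrM.
rewrite -natr_sum; congr (_%:R).
have n0 : (0 < n)%N by case: (n) i => [[]|].
have collapse t :
    (\sum_(j < n) rescount n i (j * c) (j.+1 * c) * (t == j %[mod n])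
    = rescount n i (t * c) (t.+1 * c))%N.
  have tn : (t %% n < n)%N by rewrite ltn_mod.
  rewrite (bigD1 (Ordinal tn)) //= modn_mod eqxx muln1 big1 ?addn0.
    rewrite -(@rescount_shift_period n (t %/ n * c)); congr rescount;
      rewrite {3}(divn_eq t n); ring.
  move=> j /eqP jt; case: eqP => [e|]; rewrite ?muln0 //.
  by case: jt; apply: val_inj; rewrite /= e modn_small.
under eq_bigr => j _ do rewrite big_distrr /=.
rewrite exchange_big /=; under eq_bigr => t _ do rewrite collapse.
by rewrite rescount_concat ?leq_mul // -!mulnA (mulnC d).
Qed.

Lemma mechanical_mxDn (R : nzRingType) n c q :
  mechanical_mx R n (c + q * n) = mechanical_mx R n c + q%:R *: const_mx 1.
Proof.
apply/matrixP => i j; rewrite !mxE mulr1 -natrD; congr (_%:R).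
have n0 : (0 < n)%N by case: (n) i => [[]|].
have -> : (j * (c + q * n) = j * c + (j * q) * n)%N by ring.
have -> : (j.+1 * (c + q * n) = j.+1 * c + q * n + (j * q) * n)%N by ring.
rewrite rescount_shift_period -(@rescount_cat _ _ _ (j.+1 * c)) ?leq_addr //.
  by rewrite rescount_periods.
by rewrite leq_mul.
Qed.

Lemma mechanical_mx1 (R : nzRingType) n : mechanical_mx R n 1 = 1%:M.
Proof.
apply/matrixP => i j; rewrite !mxE !muln1 /rescount big_nat1 !modn_small //.
by rewrite eq_sym.
Qed.

Lemma mechanical_mx_col0 (R : nzRingType) n c (i j : 'I_n) :
    (c < n)%N -> j = 0 :> nat ->
  mechanical_mx R n c i j = (i < c)%:R.
Proof.
move=> cn j0; rewrite mxE j0 mul0n mul1n rescount_prefix //; congr (_%:R).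
have ni := ltn_ord i.
have [ic|ci] := ltnP i c; last by rewrite divn_small //; lia.
have -> : (c + (n.-1 - i) = 1 * n + (c.-1 - i))%N by lia.
by rewrite divnMDl ?divn_small; lia.
Qed.

Lemma mechanical_mx_ones (R : nzRingType) n : mechanical_mx R n n = const_mx 1.
Proof.
have -> : mechanical_mx R n n = mechanical_mx R n (0 + 1 * n) by rewrite mul1n.
rewrite mechanical_mxDn scale1r.
by apply/matrixP => i j; rewrite !mxE !muln0 /rescount big_geq // add0r.
Qed.

(** Since J is P_n, both products are P_(cn), that is c J. *)
Lemma mechanical_mxM_ones (R : nzRingType) n c :
  (mechanical_mx R n c *m const_mx 1 = c%:R *: const_mx 1 :> 'M_n) *
  (const_mx 1 *m mechanical_mx R n c = c%:R *: const_mx 1 :> 'M_n).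
Proof.
rewrite -mechanical_mx_ones !mechanical_mxM (mulnC n c) -[(c * n)%N]add0n.
rewrite mechanical_mxDn.
suff -> : mechanical_mx R n 0 = 0 by rewrite add0r mechanical_mx_ones.
by apply/matrixP => i j; rewrite !mxE !muln0 /rescount big_geq.
Qed.

Lemma ones_mxM (R : nzRingType) n :
  (const_mx 1 : 'M[R]_n) *m (const_mx 1 : 'M_n) = n%:R *: const_mx 1.
Proof.
by have [+ _] := mechanical_mxM_ones R n n; rewrite mechanical_mx_ones.
Qed.

Definition affine_mx (R : comNzRingType) n m (d c : R) : 'M[R]_n :=
  d *: mechanical_mx R n m + c *: const_mx 1.

Lemma affine_mxM (R : comNzRingType) n m m' (d d' c c' : R) :
  affine_mx n m d c *m affine_mx n m' d' c' =
  affine_mx n (m * m') (d * d')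
    (d * c' * m%:R + c * d' * m'%:R + c * c' * n%:R).
Proof.
rewrite /affine_mx mulmxDl !mulmxDr -!scalemxAl -!scalemxAr !scalerA.
rewrite mechanical_mxM !mechanical_mxM_ones ones_mxM.
by rewrite !scalerA -addrA -!scalerDl addrA.
Qed.

(** Changing m by a multiple of n adds a multiple of J, which c absorbs. *)
Lemma affine_mx_mod (R : comNzRingType) n m m' (d c : R) : m = m' %[mod n] ->
  exists c', affine_mx n m d c = affine_mx n m' d c'.
Proof.
move=> mm'.
suff red k e : affine_mx n k d e = affine_mx n (k %% n) d (e + d * (k %/ n)%:R).
  exists (c + d * (m %/ n)%:R - d * (m' %/ n)%:R).
  by rewrite red mm' [RHS]red subrK.
rewrite /affine_mx {1}(divn_eq k n) addnC mechanical_mxDn scalerDr -addrA.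
by rewrite scalerA -scalerDl [e + _]addrC.
Qed.

Lemma affine_mx1 (R : comNzRingType) n : affine_mx n 1 1 0 = 1%:M :> 'M[R]_n.
Proof. by rewrite /affine_mx mechanical_mx1 scale0r addr0 scale1r. Qed.

(** Row i of the first column holds d + c for i < m and c otherwise, so m is the
    number of entries of that column equal to the top one. *)
Lemma affine_mx_inj (R : comNzRingType) n m m' (d d' c c' : R) :
    (0 < m)%N -> (m < n)%N -> (0 < m')%N -> (m' < n)%N -> d != 0 -> d' != 0 ->
  affine_mx n m d c = affine_mx n m' d' c' -> m = m'.
Proof.
move=> m0 mn m'0 m'n d0 d'0 eqA; have n0 : (0 < n)%N by lia.
have letter k (e f : R) (i : 'I_n) : (k < n)%N ->
    affine_mx n k e f i (Ordinal n0) = (if (i < k)%N then e + f else f).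
  move=> kn; rewrite !mxE mulr1.
  have := mechanical_mx_col0 R i kn (erefl : Ordinal n0 = 0 :> nat)%N.
  by rewrite mxE => ->; case: ltnP => _; rewrite ?mulr1 ?mulr0 ?add0r.
have same (i : 'I_n) : (i < m)%N = (i < m')%N.
  have top := congr1 (fun A : 'M_n => A (Ordinal n0) (Ordinal n0)) eqA.
  have := congr1 (fun A : 'M_n => A i (Ordinal n0)) eqA.
  move: top; rewrite /= !letter // m0 m'0 => top.
  have sub0 (e f : R) : (f == e + f) = (e == 0).
    by rewrite -{1}[f]add0r (inj_eq (addIr f)) eq_sym.
  case: ifP => im; case: ifP => im' // /eqP.
    by rewrite top eq_sym sub0 (negPf d'0).
  by rewrite -top sub0 (negPf d0).
have := same (Ordinal mn); have := same (Ordinal m'n); rewrite /= !ltnn; lia.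
Qed.

(** * From words to matrices *)

Lemma word_mx_mechanical_word (R : nzRingType) n c (w : n.-tuple bool)
    (a b : R) :
    (c < n)%N -> coprime c n -> val w = mechanical_word n c 0 ->
  word_mx w a b = (a - b) *: mechanical_mx R n c + b *: const_mx 1.
Proof.
move=> cn co wE; apply/matrixP => i j; rewrite !mxE wE.
rewrite sorted_conjugates_mechanical_word // !nth_mkseq // mulr1.
have : (rescount n i (j * c) (j.+1 * c) <= 1)%N.
  by apply: rescount_le1; lia.
by case: rescount => [|[]] //= _; rewrite ?mulr0 ?add0r // mulr1 subrK.
Qed.

Lemma christoffel_mxP (R : nzRingType) n m (a b : R) (A : 'M[R]_n) :
    (m < n)%N -> coprime m n ->
  is_christoffel_mx m a b A <->
  A = (a - b) *: mechanical_mx R n m + b *: const_mx 1.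
Proof.
move=> mn co; split=> [[w [cw cwm ->]]|->].
  apply: word_mx_mechanical_word => //.
  by rewrite [LHS](christoffel_word_unique cw) cwm size_tuple.
have sz : size (mechanical_word n m 0) == n by rewrite size_mechanical_word.
exists (Tuple sz); split; last by rewrite (@word_mx_mechanical_word _ _ m).
  split; first exact: lyndon_mechanical_word.
  exact/balanced_mechanical_word/ltnW.
rewrite -[val _]take_size size_mechanical_word.
rewrite count_take_mechanical_word ?(ltnW mn) //.
by rewrite mulnC -[(m * n)%N]add0n rescount_periods //; lia.
Qed.

(** * Types of invertible Christoffel matrices *)

(** The type is left as a relation with natural numbers, not residues, so that
    products of types need no reduction; see [has_type_mod]. *)
Definition has_type (R : comUnitRingType) n m (g : GL n R) : Prop :=
  exists d c : R, d != 0 /\ GLmx g = affine_mx n m d c.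

Lemma has_type_mod (R : comUnitRingType) n m m' (g : GL n R) :
  m = m' %[mod n] -> has_type m g -> has_type m' g.
Proof.
move=> mm' [d [c [d0 gE]]]; rewrite /has_type gE.
have [c' ->] := affine_mx_mod d c mm'; by exists d, c'.
Qed.

Lemma has_type_uniq (R : comUnitRingType) n m m' (g : GL n R) : (1 < n)%N ->
    coprime m n -> coprime m' n -> has_type m g -> has_type m' g ->
  m = m' %[mod n].
Proof.
move=> n1 co co' gm gm'.
have [d [c [d0 gE]]] := has_type_mod (esym (modn_mod m n)) gm.
have [d' [c' [d'0 gE']]] := has_type_mod (esym (modn_mod m' n)) gm'.
have pos k : coprime k n -> (0 < k %% n)%N.
  rewrite -coprime_modl lt0n; apply: contraTneq => ->.
  by rewrite /coprime gcd0n gtn_eqF.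
have lt k : (k %% n < n)%N by rewrite ltn_mod ltnW.
have eqA := etrans (esym gE) gE'.
exact: affine_mx_inj (pos _ co) (lt _) (pos _ co') (lt _) d0 d'0 eqA.
Qed.

Lemma has_typeM (R : idomainType) n m m' (g h : GL n R) :
  has_type m g -> has_type m' h -> has_type (m * m') (g * h)%g.
Proof.
move=> [d [c [d0 gE]]] [d' [c' [d'0 hE]]].
exists (d * d'), (d * c' * m%:R + c * d' * m'%:R + c * c' * n%:R).
by rewrite mulf_neq0 //= gE hE affine_mxM.
Qed.

Lemma has_type_commute (R : comUnitRingType) n m m' (g h : GL n R) :
  has_type m g -> has_type m' h -> (g * h = h * g)%g.
Proof.
move=> [d [c [_ gE]]] [d' [c' [_ hE]]]; apply: val_inj; rewrite /= gE hE.
by rewrite !affine_mxM mulnC; congr affine_mx; ring.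
Qed.

(** The all-ones vector is an eigenvector for the row sum d m + c n, and the
    difference of two rows is divisible by d; compare both with A A^-1 = 1. *)
Lemma affine_mx_units (R : comUnitRingType) n m (d c : R) : (1 < n)%N ->
    affine_mx n m d c \in unitmx ->
  d \is a GRing.unit /\ d * m%:R + c * n%:R \is a GRing.unit.
Proof.
move=> n1; set A := affine_mx _ _ _ _ => Au.
have A_ones : A *m (const_mx 1 : 'M_n) = (d * m%:R + c * n%:R) *: const_mx 1.
  rewrite mulmxDl -!scalemxAl mechanical_mxM_ones ones_mxM.
  by rewrite !scalerA scalerDl.
pose i0 := Ordinal (ltnW n1); pose i1 := Ordinal n1.
split; last first.
  have := congr1 (fun M => (invmx A *m M) i0 i0) A_ones.
  rewrite mulmxA mulVmx // mul1mx -scalemxAr !mxE => e.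
  by apply/unitrPr; exists (\sum_j invmx A i0 j * (const_mx 1 : 'M_n) j i0).
have AV i : \sum_j A i j * invmx A j i0 = (i == i0)%:R.
  by have := congr1 (fun M : 'M_n => M i i0) (mulmxV Au); rewrite !mxE.
pose P := mechanical_mx R n m.
apply/unitrPr; exists (\sum_j (P i0 j - P i1 j) * invmx A j i0).
rewrite -[RHS](AV i0) -[RHS]subr0 -[X in _ - X](AV i1).
rewrite -sumrB mulr_sumr; apply: eq_bigr => j _; rewrite !mxE; ring.
Qed.

(** Writing m m' = 1 + k n gives P_m P_m' = 1 + k J, so in the product only the
    coefficient of J is left to cancel; it is linear in f with slope the row sum
    d m + c n. *)
Lemma affine_mx_inverse (R : comUnitRingType) n m m' (d c : R) : (1 < n)%N ->
    (m * m' = 1 %[mod n])%N ->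
    d \is a GRing.unit -> d * m%:R + c * n%:R \is a GRing.unit ->
  exists f, affine_mx n m d c *m affine_mx n m' d^-1 f = 1%:M.
Proof.
move=> n1 mm' d_u; set s := _ + _ => s_u.
have mm'E : (m * m' = 1 + m * m' %/ n * n)%N.
  by rewrite {1}(divn_eq (m * m') n) mm' modn_small // addnC.
set k := (m * m' %/ n)%N in mm'E.
pose f := - (k%:R + c * d^-1 * m'%:R) / s; exists f.
rewrite affine_mxM mulrV // mm'E /affine_mx mechanical_mxDn.
rewrite mechanical_mx1 !scale1r.
rewrite -addrA -scalerDl [X in X *: _](_ : _ = 0) ?scale0r ?addr0 //.
have -> : k%:R + (d * f * m%:R + c * d^-1 * m'%:R + c * f * n%:R) =
    k%:R + c * d^-1 * m'%:R + f * s by rewrite /s; ring.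
by rewrite divrK // subrr.
Qed.

Lemma has_typeV (R : comUnitRingType) n m m' (g : GL n R) : (1 < n)%N ->
  (m * m' = 1 %[mod n])%N -> has_type m g -> has_type m' g^-1%g.
Proof.
move=> n1 mm' [d [c [d0 gE]]].
have := GLmxP g; rewrite gE => /(affine_mx_units n1)[d_u s_u].
have [f fV] := affine_mx_inverse n1 mm' d_u s_u.
exists d^-1, f; split; first by rewrite invr_eq0.
by rewrite /= -[RHS]mul1mx -(mulVmx (GLmxP g)) -mulmxA gE fV mulmx1.
Qed.

Lemma GC_typeP (R : idomainType) n (g : GL n R) : (1 < n)%N ->
  GC n R g <-> exists2 m, coprime m n & has_type m g.
Proof.
move=> n1; split=> [[m [a [b [mn co ab /(christoffel_mxP _ _ _ mn co) gE]]]]|].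
  by exists m => //; exists (a - b), b; rewrite subr_eq0.
move=> [m co /(has_type_mod (esym (modn_mod m n)))[d [c [d0 gE]]]].
have mn : (m %% n < n)%N by rewrite ltn_mod ltnW.
exists (m %% n)%N, (d + c), c; rewrite coprime_modl; split=> //.
  by rewrite -subr_eq0 addrK.
by apply/christoffel_mxP; rewrite ?coprime_modl // addrK.
Qed.

Lemma GC_type1P (R : idomainType) n (g : GL n R) : (1 < n)%N ->
  GC_type1 n R g <-> has_type 1 g.
Proof.
move=> n1; split=> [[a [b [ab]]]|[d [c [d0 gE]]]].
  move/(christoffel_mxP _ _ _ n1 (coprime1n n)) => gE.
  by exists (a - b), b; rewrite subr_eq0.
exists (d + c), c; split; first by rewrite -subr_eq0 addrK.
by apply/christoffel_mxP; rewrite ?coprime1n // addrK.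
Qed.

(** With d = 1 it suffices that the row sum m + c n be nonzero, and c = 0 or
    c = 1 works: m and n cannot both be zero in R, as
    m' m = 1 + k n for some m' and k. *)
Lemma has_type_exists (R : idomainType) n m :
    GRing.field_axiom R -> (1 < n)%N -> coprime m n ->
  exists g : GL n R, has_type m g.
Proof.
move=> Rf n1 co.
have [c s0] : exists c : R, m%:R + c * n%:R != 0.
  have [m0|m0] := eqVneq (m%:R : R) 0; last by exists 0; rewrite mul0r addr0.
  exists 1; rewrite m0 add0r mul1r; apply/negP => /eqP n0.
  have [m' m'm] := coprime_inverse_mod (ltnW n1) co.
  have := congr1 (fun k => k%:R : R) (divn_eq (m' * m) n).
  rewrite /= m'm modn_small // natrD !natrM m0 n0 !mulr0 add0r => /esym/eqP.
  by rewrite oner_eq0.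
have [m' m'm] := coprime_inverse_mod (ltnW n1) co.
have mm' : m * m' = 1 %[mod n] by rewrite mulnC.
have s_u : 1 * m%:R + c * n%:R \is a GRing.unit by apply: Rf; rewrite mul1r.
have [f /mulmx1_unit[Au _]] := affine_mx_inverse n1 mm' (unitr1 R) s_u.
by exists (MkGL Au), 1, c; rewrite oner_eq0.
Qed.

Lemma unit_Zp_nat n (u : {unit 'Z_n}) : (1 < n)%N ->
  coprime (val u : 'Z_n) n.
Proof.
move=> n1; have := valP u.
by rewrite /= -{1}(natr_Zp (val u)) unitZpE // coprime_sym.
Qed.

(** The quotient isomorphism must be defined on arbitrary sets; the default
    value 1 concerns only sets containing no element with a type prime to n. *)
Definition set_type (R : idomainType) n (X : set (GL n R)) : {unit 'Z_n} :=
  xget (1%g : {unit 'Z_n})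
    [set u : {unit 'Z_n} | exists2 g, X g & has_type (val u : 'Z_n) g].

Lemma set_typeE (R : idomainType) n (X : set (GL n R)) m : (1 < n)%N ->
    coprime m n -> (exists g, X g) -> (forall g, X g -> has_type m g) ->
  val (set_type X) = m%:R.
Proof.
move=> n1 co [g Xg] Xm; rewrite /set_type.
have mu : (m%:R : 'Z_n) \is a GRing.unit by rewrite unitZpE // coprime_sym.
case: xgetP => [u _ [h Xh hu]|/(_ (FinRing.Unit mu))[]]; last first.
  exists g => //; apply: has_type_mod (Xm _ Xg).
  by rewrite /= val_Zp_nat // modn_mod.
have := has_type_uniq n1 (unit_Zp_nat u n1) co hu (Xm _ Xh).
move=> um; apply: val_inj => /=.
by rewrite val_Zp_nat // -um modn_small // -[X in (_ < X)%N](Zp_cast n1).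
Qed.

Lemma GC_subgroup (R : idomainType) n : (1 < n)%N -> is_subgroup (GC n R).
Proof.
move=> n1; split.
- apply/GC_typeP => //; exists 1%N; first exact: coprime1n.
  by exists 1, 0; rewrite oner_eq0 affine_mx1.
- move=> g h /(GC_typeP _ n1)[m co gm] /(GC_typeP _ n1)[m' co' hm'].
  apply/GC_typeP => //; exists (m * m')%N; first by rewrite coprimeMl co.
  exact: has_typeM.
- move=> g /(GC_typeP _ n1)[m co gm]; apply/GC_typeP => //.
  have [m' m'm] := coprime_inverse_mod (ltnW n1) co.
  exists m'; last by apply: has_typeV gm; rewrite // mulnC.
  have : coprime (m' * m) n by rewrite -coprime_modl m'm coprime_modl coprime1n.
  by rewrite coprimeMl => /andP[].
Qed.

Lemma GC_abelian (R : idomainType) n : (1 < n)%N -> is_abelian (GC n R).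
Proof.
move=> n1 g h /(GC_typeP _ n1)[m _ gm] /(GC_typeP _ n1)[m' _ hm'].
exact: has_type_commute gm hm'.
Qed.

Lemma GC_type1_subgroup (R : idomainType) n : (1 < n)%N ->
  is_subgroup (GC_type1 n R).
Proof.
move=> n1; split.
- by apply/GC_type1P => //; exists 1, 0; rewrite oner_eq0 affine_mx1.
- move=> g h /(GC_type1P _ n1) gm /(GC_type1P _ n1) hm.
  by apply/GC_type1P => //; exact: has_typeM gm hm.
- move=> g /(GC_type1P _ n1) gm; apply/GC_type1P => //.
  exact: has_typeV gm.
Qed.

Lemma left_coset_type (R : idomainType) n m (g : GL n R) : (1 < n)%N ->
  has_type m g -> forall x, left_coset g (GC_type1 n R) x -> has_type m x.
Proof.
move=> n1 gm _ [h /(GC_type1P _ n1) h1 <-].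
by rewrite -[m]muln1; apply: has_typeM.
Qed.

(** Multiplicativity follows from [set_typeE] applied to the product of two
    cosets, whose elements all have the product type.  Two cosets of equal type
    coincide because the quotient of their representatives has type 1. *)
Lemma GC_quotient (R : idomainType) n : (1 < n)%N -> GRing.field_axiom R ->
  quotient_isomorphic (GC n R) (GC_type1 n R) {unit 'Z_n}.
Proof.
move=> n1 Rf; set H := GC_type1 n R.
have [H1 HM HV] := GC_type1_subgroup R n1.
have cosetP X : cosets_of (GC n R) H X ->
    exists g m, [/\ X = left_coset g H, X g, coprime m n, has_type m g
                  & val (set_type X) = m%:R].
  move=> [g /(GC_typeP _ n1)[m co gm] <-].
  have gX : left_coset g H g by exists 1%g => //; rewrite mulg1.
  exists g, m; split=> //; apply: set_typeE => //; first by exists g.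
  exact: left_coset_type.
exists (@set_type R n); split; last first.
  move=> X Y /cosetP[g [m [Xg gX co gm Xm]]].
  move=> /cosetP[h [m' [Yh hY co' hm' Ym']]].
  apply: val_inj; rewrite FinRing.val_unitM Xm Ym' -natrM.
  apply: set_typeE => //.
  - by rewrite coprimeMl co.
  - by exists (g * h)%g; exists g => //; exists h.
  - move=> _ [x Xx [y Yy <-]]; apply: has_typeM.
      by apply: left_coset_type gm _ _ => //; rewrite -/H -Xg.
    by apply: left_coset_type hm' _ _ => //; rewrite -/H -Yh.
split=> //.
- move=> X Y /set_mem/cosetP[g [m [-> gX co gm Xm]]].
  move=> /set_mem/cosetP[h [m' [-> hY co' hm' Ym']]] eqXY.
  have mm' : m = m' %[mod n].
    have := congr1 val eqXY; rewrite Xm Ym' => /(congr1 (@nat_of_ord _)).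
    by rewrite !val_Zp_nat.
  have Hgh : H (g^-1 * h)%g.
    apply/GC_type1P => //.
    have [k km] := coprime_inverse_mod (ltnW n1) co.
    apply: (has_type_mod km); apply: has_typeM.
      by apply: has_typeV gm; rewrite // mulnC.
    exact: has_type_mod (esym mm') hm'.
  apply/seteqP; split=> _ [x Hx <-].
    exists ((g^-1 * h)^-1 * x)%g; first by apply: HM => //; apply: HV.
    by rewrite invgM invgK !mulgA mulgV mul1g.
  by exists (g^-1 * h * x)%g; [exact: HM | rewrite !mulgA mulgV mul1g].
- move=> u _; have co := unit_Zp_nat u n1.
  have [g gu] := has_type_exists Rf n1 co.
  have cg : cosets_of (GC n R) H (left_coset g H).
    by exists g => //; apply/GC_typeP => //; exists (val u : 'Z_n).
  exists (left_coset g H) => //; apply: val_inj.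
  rewrite -[RHS]natr_Zp; apply: set_typeE => //; last exact: left_coset_type.
  by exists g; exists 1%g => //; rewrite mulg1.
Qed.

Theorem corollary4 (R : idomainType) (n : nat) (n_ge2 : (2 <= n)%N) :
  [/\ is_subgroup (GC n R) /\ is_abelian (GC n R),
      is_subgroup (GC_type1 n R) /\ GC_type1 n R `<=` GC n R
    & GRing.field_axiom R ->
      quotient_isomorphic (GC n R) (GC_type1 n R) {unit 'Z_n}].
Proof.
split; last exact: GC_quotient.
  by split; [exact: GC_subgroup | exact: GC_abelian].
split; first exact: GC_type1_subgroup.
move=> g /(GC_type1P _ n_ge2) g1; apply/GC_typeP => //.
by exists 1%N => //; apply: coprime1n.
Qed.
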